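(* Let $K=\mathbb{F}_q$ be a finite field with $q\neq 2$. Let $G$ be a connected graph and let $X$ be the projective algebraic toric set parameterized by the edges of $G$ (defined in the context). Then $I(X)$ is a complete intersection if and only if $G$ is a tree or $G$ is a unicyclic graph whose unique cycle is odd.
   Context: Graphs are finite and simple. A graph is unicyclic if it has exactly one cycle. Let $G$ have vertex set $\{y_1,\ldots,y_n\}$ and edges $f_1,\ldots,f_s$ ($s\geq 1$), and let $v_i=e_j+e_k\in\{0,1\}^n$ be the characteristic vector of $f_i=\{y_j,y_k\}$. Put $K^*=K\setminus\{0\}$ and, for $x\in (K^* )^n$, $x^{v_i}=x_1^{v_{i1}}\cdots x_n^{v_{in}}$. The projective algebraic toric set parameterized by the edges of $G$ is $X=\{[(x^{v_1},\ldots,x^{v_s})] : x\in (K^* )^n\}\subset\mathbb{P}^{s-1}$, the projective space over $K$. $S=K[t_1,\ldots,t_s]$ is a polynomial ring with the standard grading, and $I(X)$ is the ideal of $S$ generated by the homogeneous polynomials vanishing on $X$ (it has height $s-1$). $I(X)$ is called a complete intersection if it can be generated by $s-1$ homogeneous polynomials of $S$. *)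

(* Defs.v *)
From mathcomp Require Import all_boot all_order all_algebra.
From mathcomp Require Import mpoly.

Set Implicit Arguments.
Unset Strict Implicit.
Unset Printing Implicit Defensive.

Import GRing.Theory.
Local Open Scope ring_scope.

(* A finite simple graph on the vertices y_1, .., y_n with its edges listed as
   f_1, .., f_s: an edge is a set of two distinct vertices, and distinct indices
   give distinct edges. *)
Record graph (n s : nat) := Graph {
  edge : 'I_s -> {set 'I_n};
  edge_inj : injective edge;
  edge_card : forall i, #|edge i| = 2%N
}.

Section Graphs.
Variables (n s : nat) (G : graph n s).

Definition adj : rel 'I_n := fun x y => [exists i, edge G i == [set x; y]].

Definition connected_graph : Prop := forall x y, connect adj x y.

(* The indices of the edges joining cyclically consecutive vertices of p. *)
Definition closed_walk_edges (p : seq 'I_n) : {set 'I_s} :=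
  [set i | [exists x in p, edge G i == [set x; next p x]]].

(* A cycle is a subgraph, determined by its edges; hence the rotations and the
   reversal of a cyclic vertex sequence all describe the same cycle. *)
Definition is_cycle (C : {set 'I_s}) : Prop :=
  exists p : seq 'I_n,
    [/\ (2 < size p)%N, ucycle adj p & C = closed_walk_edges p].

Definition is_tree : Prop := connected_graph /\ (forall C, ~ is_cycle C).

Definition unicyclic : Prop := exists! C, is_cycle C.

Definition odd_unicyclic : Prop :=
  unicyclic /\ (forall C, is_cycle C -> odd #|C|).

Definition edge_vec (i : 'I_s) : 'X_{1..n} :=
  [multinom (j \in edge G i : nat) | j < n].

End Graphs.

(* The projective space of dimension s - 1 over K: the lines through the origin
   in K^s. *)
Definition proj_space (K : fieldType) (s : nat) : Type :=
  {l : {vspace 'rV[K]_s} | \dim l == 1%N}.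

Section ToricSet.
Variables (K : fieldType) (n s : nat).

Definition edge_monomials (G : graph n s) (x : 'I_n -> K) : 'rV[K]_s :=
  \row_i \prod_(j < n) x j ^+ edge_vec G i j.

Definition toric_set (G : graph n s) (P : proj_space K s) : Prop :=
  exists x : 'I_n -> K,
    (forall j, x j != 0) /\ val P = <[edge_monomials G x]>%VS.

End ToricSet.

Section VanishingIdeal.
Variables (K : fieldType) (s : nat).

Definition homogeneous (p : {mpoly K[s]}) : Prop := exists d, p \is d.-homog.

(* Vanishing at P means vanishing on all homogeneous coordinates of P. *)
Definition vanishes_at (p : {mpoly K[s]}) (P : proj_space K s) : Prop :=
  forall v : 'rV[K]_s, v \in val P -> v != 0 -> p.@[v 0] = 0.

Definition ideal_gen (A : {mpoly K[s]} -> Prop) (h : {mpoly K[s]}) : Prop :=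
  exists (k : nat) (c g : 'I_k -> {mpoly K[s]}),
    (forall i, A (g i)) /\ h = \sum_(i < k) c i * g i.

Definition vanishing_ideal (X : proj_space K s -> Prop) :
    {mpoly K[s]} -> Prop :=
  ideal_gen (fun p => homogeneous p /\ (forall P, X P -> vanishes_at p P)).

(* For ideals I of height s - 1, such as the vanishing ideal of a nonempty
   finite subset of the projective space of dimension s - 1. *)
Definition complete_intersection (I : {mpoly K[s]} -> Prop) : Prop :=
  exists g : 'I_s.-1 -> {mpoly K[s]},
    (forall i, homogeneous (g i)) /\
    (forall h, I h <-> ideal_gen (fun p => exists i, p = g i) h).

End VanishingIdeal.

(* Main.v *)
Require Import Defs.
From mathcomp Require Import all_boot all_order all_algebra all_field.
From mathcomp Require Import mpoly.
From Stdlib Require Classical_Prop.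

(* Let m = q - 1. On the torus the monomials t^a are characters, so by linear
   independence of characters a homogeneous polynomial vanishes on X iff its
   coefficients sum to zero over each class of monomials with the same vertex
   weights modulo m. No other monomial of degree r < m lies in the class of
   t_j^r, so forms of degree < m in I(X) have no pure powers, whereas I(X)
   contains the s - 1 binomials t_i^m - t_0^m. Hence s - 1 generators must all
   have degree m and span the same space as these binomials, and I(X) is a
   complete intersection iff it is generated by them, i.e. iff the edge vectors,
   extended by a last coordinate 1, are independent modulo m.
   Combinatorially, this independence fails exactly when some even closed walk
   has a nontrivial alternating edge sum: on an even cycle, or on two odd cycles
   joined by a walk. *)

Set Implicit Arguments.
Unset Strict Implicit.
Unset Printing Implicit Defensive.

Import GRing.Theory.
Local Open Scope ring_scope.

(** * Power sums and characters over a finite field *)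

Section FiniteFieldPowers.
Variable K : finFieldType.
Local Notation m := (#|K|.-1).

Lemma cardK_pred_gt0 : (0 < m)%N.
Proof. by rewrite -subn1 subn_gt0 finNzRing_gt1. Qed.

Lemma expf_card_pred (x : K) : x != 0 -> x ^+ m = 1.
Proof.
move=> x0; apply: (mulfI x0).
by rewrite -exprS prednK ?expf_card ?mulr1 // ltnW // finNzRing_gt1.
Qed.

Lemma expf_dvd (x : K) (k : nat) : x != 0 -> (m %| k)%N -> x ^+ k = 1.
Proof.
by move=> x0 /dvdnP[d ->]; rewrite mulnC exprM expf_card_pred // expr1n.
Qed.

(** Otherwise all [m] nonzero elements would be roots of [X^r - 1], where [0 < r < m] is the
    remainder of [k]. *)
Lemma dvd_card_pred (k : nat) :
  (forall y : K, y != 0 -> y ^+ k = 1) -> (m %| k)%N.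
Proof.
move=> yk; rewrite /dvdn; apply: contraT; rewrite -lt0n => r0.
suff : (m <= k %% m)%N by rewrite leqNgt ltn_pmod // cardK_pred_gt0.
have {1}-> : m = size (enum (predC1 (0 : K))) by rewrite -cardE cardC1.
apply: (max_unity_roots r0); rewrite ?enum_uniq //; apply/allP => y.
rewrite mem_enum !inE => y0; rewrite unity_rootE.
by rewrite -(yk y y0) {2}(divn_eq k m) exprD expf_dvd ?dvdn_mull // mul1r.
Qed.

Lemma natr_cardK : #|K|%:R = 0 :> K.
Proof.
have := reindex_inj (h := fun x : K => x + 1) (addIr 1) (F := id) (P := predT)
  (op := +%R) (x := 0).
rewrite /= big_split /= sumr_const => /eqP.
by rewrite -{1}[X in X == _]addr0 (inj_eq (addrI _)) => /eqP <-.
Qed.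

(** If [m] does not divide [k], some nonzero [y] has [y^k != 1]; multiplication by [y] permutes the
    nonzero elements and scales the sum by [y^k], so the sum is 0. *)
Lemma sum_powers_neq0 (k : nat) :
  \sum_(y : K | y != 0) y ^+ k = if (m %| k)%N then -1 else 0.
Proof.
case: ifP => [mk | /negP mk].
  rewrite (eq_bigr (fun=> 1)) => [|y y0]; last exact: expf_dvd.
  rewrite (sumr_const (predC1 (0 : K))) cardC1 -subn1 natrB ?natr_cardK ?sub0r //.
  exact: ltnW (finNzRing_gt1 K).
have [y y0 yk] : exists2 y : K, y != 0 & y ^+ k != 1.
  case: (pickP [pred y : K | (y != 0) && (y ^+ k != 1)]) => [y /andP[]|all1].
    by exists y.
  case: mk; apply: dvd_card_pred => y y0; apply/eqP.
  by have := all1 y; rewrite /= y0 => /negbFE.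
have := reindex_inj (mulfI y0) (F := fun x : K => x ^+ k)
  (P := fun x => x != 0) (op := +%R) (x := 0).
under [RHS]eq_bigl => x do rewrite mulf_eq0 (negbTE y0).
under [RHS]eq_bigr => x _ do rewrite exprMn.
rewrite -mulr_sumr => /eqP.
rewrite -{1}[\sum_(_ | _) _]mul1r -subr_eq0 -mulrBl mulf_eq0 subr_eq0 eq_sym.
by rewrite (negbTE yk) => /eqP.
Qed.

(* Orthogonality of the characters [x |-> \prod_j x_j ^+ w a j] of the torus
   [(K \ 0)^n]: pair the vanishing combination with the inverse of the character
   of exponent [e], i.e. with exponent [m.-1 * e]. *)
Lemma torus_char_indep (n : nat) (A : Type) (r : seq A) (f : A -> K)
    (w : A -> 'I_n -> nat) (e : 'I_n -> nat) :
  (forall x : 'I_n -> K, (forall j, x j != 0) ->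
     \sum_(a <- r) f a * \prod_j x j ^+ w a j = 0) ->
  \sum_(a <- r | [forall j, w a j == e j %[mod m]]) f a = 0.
Proof.
move=> sum0.
have eqm a j : (m %| w a j + m.-1 * e j)%N = (w a j == e j %[mod m]).
  have me : (w a j + m.-1 * e j + e j = w a j + m * e j)%N.
    by rewrite -addnA addnC -mulSnr prednK ?cardK_pred_gt0 // addnC.
  by rewrite /dvdn -(mod0n m) -(eqn_modDr (e j)) me add0n -modnDmr modnMr addn0.
have : \sum_(x : {ffun 'I_n -> K} | x \in ffun_on (predC1 0))
   \sum_(a <- r) f a * \prod_j x j ^+ (w a j + m.-1 * e j) = 0.
  apply: big1 => x /ffun_onP x0.
  transitivity ((\sum_(a <- r) f a * \prod_j x j ^+ w a j)
                  * \prod_j x j ^+ (m.-1 * e j)).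
    rewrite mulr_suml; apply: eq_bigr => a _; rewrite -mulrA -big_split /=.
    by congr (_ * _); apply: eq_bigr => j _; rewrite exprD.
  by rewrite sum0 ?mul0r // => j; have := x0 j; rewrite !inE.
(* The inner sum over the torus factors into one power sum per coordinate, each -1 or 0; the
   surviving terms all carry the sign [(-1)^n]. *)
rewrite exchange_big /=.
under eq_bigr => a _.
  rewrite -mulr_sumr -(bigA_distr_big _ (fun j (y : K) =>
    y ^+ (w a j + m.-1 * e j))) /=.
  under eq_bigr => j _ do rewrite sum_powers_neq0 eqm.
  over.
move=> /eqP s0; apply/eqP.
have : (\sum_(a <- r | [forall j, w a j == e j %[mod m]]) f a) * (-1) ^+ n == 0.
  rewrite -[X in _ == X](eqP s0) mulr_suml big_mkcond /=.
  apply/eqP/eq_bigr => a _.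
  case: ifP => [/forallP wa | /negP wa].
    rewrite (eq_bigr (fun=> -1)) ?prodr_const ?card_ord // => j _.
    by rewrite wa.
  have [j wj] : exists j, w a j != e j %[mod m].
    by apply/existsP; rewrite -negb_forall; apply/negP.
  by rewrite (bigD1 j) //= (negbTE wj) mul0r mulr0.
by rewrite mulf_eq0 signr_eq0 orbF.
Qed.

End FiniteFieldPowers.

(** * Calculus and congruences in a generated ideal *)

Section IdealGen.
Variables (K : fieldType) (s : nat).
Implicit Types (A B : {mpoly K[s]} -> Prop) (p q h c : {mpoly K[s]}).

Lemma ideal_gen_mem A p : A p -> ideal_gen A p.
Proof.
by move=> Ap; exists 1%N, (fun=> 1), (fun=> p); rewrite big_ord1 mul1r.
Qed.

Lemma ideal_gen0 A : ideal_gen A 0.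
Proof.
by exists 0%N, (fun=> 0), (fun=> 0); split=> [[]|] //; rewrite big_ord0.
Qed.

Lemma ideal_genD A p q : ideal_gen A p -> ideal_gen A q -> ideal_gen A (p + q).
Proof.
move=> [k1 [c1 [g1 [Ag1 ->]]]] [k2 [c2 [g2 [Ag2 ->]]]].
pose glue (f1 : 'I_k1 -> {mpoly K[s]}) (f2 : 'I_k2 -> {mpoly K[s]}) i :=
  match split i with inl j => f1 j | inr j => f2 j end.
exists (k1 + k2)%N, (glue c1 c2), (glue g1 g2); split=> [i|].
  by rewrite /glue; case: (split i).
rewrite big_split_ord /glue /=; congr (_ + _); apply: eq_bigr => i _.
  by rewrite -/(unsplit (inl i)) unsplitK.
by rewrite -/(unsplit (inr i)) unsplitK.
Qed.

Lemma ideal_genM A c p : ideal_gen A p -> ideal_gen A (c * p).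
Proof.
move=> [k [d [g [Ag ->]]]]; exists k, (fun i => c * d i), g; split=> //.
by rewrite mulr_sumr; apply: eq_bigr => i _; rewrite mulrA.
Qed.

Lemma ideal_gen_sum A (I : Type) (r : seq I) (P : pred I) F :
  (forall i, P i -> ideal_gen A (F i)) -> ideal_gen A (\sum_(i <- r | P i) F i).
Proof.
by move=> AF; apply: big_ind => //; [exact: ideal_gen0|exact: ideal_genD].
Qed.

Lemma ideal_gen_trans A B h :
  (forall p, A p -> ideal_gen B p) -> ideal_gen A h -> ideal_gen B h.
Proof.
move=> AB [k [c [g [Ag ->]]]].
by apply: ideal_gen_sum => i _; apply/ideal_genM/AB.
Qed.

Lemma ideal_gen_family k (g : 'I_k -> {mpoly K[s]}) h :
  ideal_gen (fun p => exists i, p = g i) h ->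
  exists c : 'I_k -> {mpoly K[s]}, h = \sum_i c i * g i.
Proof.
move=> [l [c [g' [/fin_all_exists[f g'E] ->]]]].
exists (fun i => \sum_(j | f j == i) c j).
rewrite (partition_big f predT) //=; apply: eq_bigr => i _.
by rewrite mulr_suml; apply: eq_bigr => j /eqP <-; rewrite g'E.
Qed.

(** Here and in the next two lemmas, [ideal_gen A (p - p')] stands for congruence modulo the
    ideal. *)
Lemma ideal_gen_congM A p p' q q' :
  ideal_gen A (p - p') -> ideal_gen A (q - q') ->
  ideal_gen A (p * q - p' * q').
Proof.
move=> Jp Jq; have -> : p * q - p' * q' = p * (q - q') + q' * (p - p').
  by rewrite !mulrBr ![q' * _]mulrC addrA subrK.
by apply: ideal_genD; apply: ideal_genM.
Qed.

Lemma ideal_gen_congX A p p' k :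
  ideal_gen A (p - p') -> ideal_gen A (p ^+ k - p' ^+ k).
Proof.
move=> Jp; elim: k => [|k IHk]; first by rewrite !expr0 subrr; apply: ideal_gen0.
by rewrite !exprS; apply: ideal_gen_congM.
Qed.

Lemma ideal_gen_cong_prod A (I : Type) (r : seq I) F F' :
  (forall i, ideal_gen A (F i - F' i)) ->
  ideal_gen A (\prod_(i <- r) F i - \prod_(i <- r) F' i).
Proof.
move=> JF; elim/big_ind2: _ => // [|p p' q q'].
  by rewrite subrr; apply: ideal_gen0.
exact: ideal_gen_congM.
Qed.

End IdealGen.

(** * Coefficients of products and of homogeneous polynomials *)

Section MpolyCoefficients.
Variables (K : fieldType) (s : nat).
Implicit Types (p c : {mpoly K[s]}) (a b : 'X_{1..s}).

(** Of the factorizations of the monomial [b], only 1 times [b] contributes, as [p] has no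
    coefficient at a proper divisor of [b]. *)
Lemma mcoeffM_lowest c p b :
  (forall a, (a <= b)%MM -> a != b -> p@_a = 0) ->
  (c * p)@_b = c@_0 * p@_b.
Proof.
move=> low; rewrite mcoeffMr.
have b_lt : (mdeg b < (mdeg b).+1)%N by [].
have z_lt : (mdeg (0%MM : 'X_{1..s}) < (mdeg b).+1)%N by rewrite mdeg0.
rewrite (bigD1 (BMultinom b_lt, BMultinom z_lt)) /=; last by rewrite addm0.
rewrite big1 ?addr0 // => -[a a'] /= /andP[/eqP bE ne].
rewrite low ?mulr0 //.
  by apply/mnm_lepP => i; rewrite [in X in (_ <= X)%N]bE mnmDE leq_addr.
apply: contra ne => /eqP aE.
have a'0 : (a' : 'X_{1..s}) = 0%MM.
  apply/mnmP => i; have /mnmP/(_ i)/eqP := bE.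
  by rewrite mnmDE mnm0E aE -[X in X == _]addn0 eqn_add2l => /eqP <-.
by rewrite xpair_eqE -!val_eqE /= aE a'0 !eqxx.
Qed.

Lemma mcoeff_homog d p a : p \is d.-homog -> mdeg a != d -> p@_a = 0.
Proof.
move=> /dhomogP hp ad; apply: memN_msupp_eq0.
by apply: contra ad => /hp ->.
Qed.

Lemma lem_mdeg_lt a b : (a <= b)%MM -> a != b -> (mdeg a < mdeg b)%N.
Proof.
move=> ab ne; rewrite -(submK ab) mdegD -[X in (X < _)%N]add0n ltn_add2r lt0n.
by rewrite mdeg_eq0; apply: contra ne => /eqP ba; rewrite -(submK ab) ba add0m.
Qed.

Lemma lem_mulmn1 j d a : (a <= U_(j) *+ d)%MM -> a = (U_(j) *+ mdeg a)%MM.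
Proof.
move=> /mnm_lepP le; have a0 i : i != j -> a i = 0%N.
  move=> ij; apply/eqP; rewrite -leqn0; apply: leq_trans (le i) _.
  by rewrite mulmnE mnm1E eq_sym (negbTE ij).
apply/mnmP => i; rewrite mulmnE mnm1E mdegE (bigD1 j) //= big1 // addn0.
by case: eqVneq => [->|ne]; rewrite ?mul1n // a0 // eq_sym.
Qed.

Lemma meval_homogZ d p (k : K) (v : 'I_s -> K) :
  p \is d.-homog -> p.@[fun i => k * v i] = k ^+ d * p.@[v].
Proof.
move=> /dhomogP hp; rewrite !mevalE mulr_sumr big_seq [RHS]big_seq.
apply: eq_bigr => a /hp /= da; rewrite mulrCA; congr (_ * _).
rewrite -da mdegE -prodrXr -big_split /=.
by apply: eq_bigr => i _; rewrite exprMn.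
Qed.

End MpolyCoefficients.

(** * From projective points to parameter vectors *)

Section Parameterization.
Variables (K : fieldType) (n s : nat) (G : graph n s).

Definition vanishes_on_param (p : {mpoly K[s]}) : Prop :=
  forall x : 'I_n -> K, (forall j, x j != 0) -> p.@[edge_monomials G x 0] = 0.

Lemma edge_monomialsE (x : 'I_n -> K) i :
  edge_monomials G x 0 i = \prod_(j in edge G i) x j.
Proof.
rewrite mxE [RHS]big_mkcond; apply: eq_bigr => j _; rewrite mnmE.
by case: (j \in _); rewrite ?expr1 ?expr0.
Qed.

Lemma edge_monomials_neq0 (x : 'I_n -> K) i :
  (forall j, x j != 0) -> edge_monomials G x 0 i != 0.
Proof. by move=> x0; rewrite edge_monomialsE; apply/prodf_neq0 => j _. Qed.

Lemma prod_edge_monomials (x : 'I_n -> K) (a : 'I_s -> nat) :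
  \prod_i edge_monomials G x 0 i ^+ a i
    = \prod_j x j ^+ (\sum_(i | j \in edge G i) a i)%N.
Proof.
under eq_bigr => i _ do rewrite edge_monomialsE -prodrXl.
under [RHS]eq_bigr => j _ do rewrite -prodrXr.
by rewrite (exchange_big_dep predT).
Qed.

(** A point of the toric set is the line through a parameter vector, along which a form scales by
    [k^d]. As [0 < s], that vector has a coordinate, hence is nonzero and spans a point. *)
Lemma toric_set_vanishesP (p : {mpoly K[s]}) :
  (0 < s)%N -> homogeneous p ->
  (forall P, toric_set G P -> vanishes_at p P) <-> vanishes_on_param p.
Proof.
move=> s0 [d hp]; split=> [pX x x0 | px P [x [x0 Px]] v].
  have m0 : edge_monomials G x != 0.
    apply/eqP => /rowP/(_ (Ordinal s0))/eqP.
    by rewrite [X in _ == X]mxE (negbTE (edge_monomials_neq0 _ x0)).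
  have dim1 : \dim <[edge_monomials G x]> == 1%N by rewrite dim_vline m0.
  pose P : proj_space K s :=
    exist (fun l : {vspace 'rV_s} => \dim l == 1%N) _ dim1.
  have X_x : toric_set G P by exists x.
  exact: pX X_x _ (memv_line _) m0.
rewrite Px => /vlineP[k ->] _.
rewrite (meval_eq (v2 := fun i => k * edge_monomials G x 0 i)) => [|i].
  by rewrite (meval_homogZ _ _ hp) px ?mulr0.
by rewrite mxE.
Qed.

Lemma vanishing_ideal_gen (h : {mpoly K[s]}) : (0 < s)%N ->
  vanishing_ideal (toric_set G) h <->
  ideal_gen (fun p => homogeneous p /\ vanishes_on_param p) h.
Proof.
move=> s0; split; apply: (@ideal_gen_trans K s) => p [hp pX].
  by apply: ideal_gen_mem; split=> //; apply/toric_set_vanishesP.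
by apply: ideal_gen_mem; split=> //; apply/toric_set_vanishesP.
Qed.

Lemma ideal_gen_vanishes (v : 'I_s -> K) (A : {mpoly K[s]} -> Prop)
    (h : {mpoly K[s]}) :
  (forall p, A p -> p.@[v] = 0) -> ideal_gen A h -> h.@[v] = 0.
Proof.
move=> Av [k [c [g [Ag ->]]]]; rewrite raddf_sum big1 // => i _.
by rewrite [LHS](mevalM v (c i)) (Av _ (Ag i)) mulr0.
Qed.

Lemma vanishing_ideal_vanishes (h : {mpoly K[s]}) : (0 < s)%N ->
  vanishing_ideal (toric_set G) h -> vanishes_on_param h.
Proof.
move=> s0 /vanishing_ideal_gen-/(_ s0) hI x x0.
by apply: ideal_gen_vanishes hI => p [_]; apply.
Qed.

End Parameterization.

(** * Coefficient sums over weight classes *)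

Section FiniteField.
Variables (K : finFieldType) (n s : nat) (G : graph n s).
Local Notation m := (#|K|.-1).

(** At a parameter point [t^a] is the character whose exponent at a vertex is the sum of [a] over
    the incident edges, so orthogonality applies. *)
Lemma vanishes_on_param_class (p : {mpoly K[s]}) (b : 'I_s -> nat) :
  vanishes_on_param G p ->
  \sum_(a <- msupp p | [forall j : 'I_n,
     (\sum_(i | j \in edge G i) a i)%N
       == (\sum_(i | j \in edge G i) b i)%N %[mod m]]) p@_a = 0.
Proof.
move=> px; apply: (torus_char_indep
  (w := fun (a : 'X_{1..s}) j => (\sum_(i | j \in edge G i) a i)%N)).
move=> x /px; rewrite mevalE => {2}<-; apply: eq_bigr => a _.
by rewrite prod_edge_monomials.
Qed.

(* If [b] has degree [r < m] and the same weight modulo [m] as [t_j ^ r], then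
   both endpoints of the edge [j] lie on every edge occurring in [b]; distinct
   edges being distinct sets, [b] is [t_j ^ r]. *)
Lemma vanishes_on_param_pure r (p : {mpoly K[s]}) j : (r < m)%N ->
  p \is r.-homog -> vanishes_on_param G p -> p@_(U_(j) *+ r) = 0.
Proof.
move=> rm hp px; have := vanishes_on_param_class (U_(j) *+ r)%MM px.
rewrite big_seq_cond (eq_bigl (fun a => (a \in msupp p) && (a == U_(j) *+ r)%MM)).
  rewrite -big_seq_cond; case: (boolP (U_(j) *+ r \in msupp p)%MM).
    move=> /[dup] jp; rewrite -big_filter => /filter_pred1_uniq -> //.
    by rewrite big_seq1.
  by move/memN_msupp_eq0.
move=> a; case: (boolP (a \in msupp p)) => //= /(dhomogP _ _ _ hp) /= da.
apply/forallP/eqP => [wa | -> //].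
have wj x : (\sum_(i | x \in edge G i) (U_(j) *+ r)%MM i
               = (x \in edge G j) * r)%N.
  under eq_bigr => i _ do rewrite mulmnE mnm1E.
  rewrite big_mkcond (bigD1 j) //= eqxx big1 ?addn0 ?mul1n.
    by case: (x \in _); rewrite ?mul1n ?mul0n.
  by move=> i ij; rewrite eq_sym (negbTE ij) mul0n if_same.
apply/mnmP => i; rewrite mulmnE mnm1E.
have a0 k : j != k -> a k = 0%N.
  move=> jk; apply/eqP; apply: contraNT jk => ak; apply/eqP/(edge_inj (g := G)).
  apply/eqP; rewrite eqEcard !edge_card leqnn andbT.
  apply/subsetP => x xj; apply: contraNT ak => xk.
  have := wa x; rewrite wj xj mul1n.
  (* Both weights at [x] are at most [r < m], so their congruence is an equality; the edges through
     [x] then use up the degree of [a], leaving none for [k]. *)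
  have le : (\sum_(i0 | x \in edge G i0) a i0 <= r)%N.
    rewrite -da mdegE [X in (_ <= X)%N](bigID (fun i0 => x \in edge G i0)) /=.
    exact: leq_addr.
  rewrite !modn_small ?(leq_ltn_trans le) // => /eqP we.
  move: da; rewrite mdegE (bigID (fun i0 => x \in edge G i0)) /= we => /eqP.
  rewrite -[X in _ == X]addn0 eqn_add2l sum_nat_eq0 => /forallP/(_ k).
  by rewrite xk.
case: eqVneq => [<-|ji]; last by rewrite a0.
rewrite mul1n -da mdegE (bigD1 j) //= big1 ?addn0 // => k kj.
by rewrite a0 // eq_sym.
Qed.

End FiniteField.

(** Linear independence modulo [m] of the vectors [(v_i, 1)], with integer lifts of the
    coefficients; the last coordinate records the degree. *)
Definition edge_independent (m n s : nat) (G : graph n s) : Prop :=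
  forall c : 'I_s -> int,
    (forall x : 'I_n, (m %| \sum_(i | x \in edge G i) c i)%Z) ->
    (m %| \sum_i c i)%Z -> forall i, (m %| c i)%Z.

(** Replaces integer coefficients by nonnegative residues, which can serve as exponents. *)
Lemma dvdz_sum_modz (m : nat) (I : finType) (P : pred I) (c : I -> int) :
  (0 < m)%N ->
  (m %| \sum_(i | P i) c i)%Z = (m %| \sum_(i | P i) `|(c i %% m)%Z|)%N.
Proof.
move=> m0; have mZ : m%:Z != 0 by rewrite eqz_nat -lt0n.
have -> : \sum_(i | P i) c i = (\sum_(i | P i) (c i %/ m)%Z) * m%:Z
    + (\sum_(i | P i) `|(c i %% m)%Z|%N)%N%:Z.
  rewrite (big_morph Posz PoszD (erefl _)) mulr_suml -big_split /=.
  by apply: eq_bigr => i _; rewrite gez0_abs ?modz_ge0 // -divz_eq.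
by rewrite rpredDl ?dvdz_mull // dvdzE !absz_nat.
Qed.

(** * Complete intersection implies independence *)

Section CompleteIntersection.
Variables (K : finFieldType) (n s' : nat) (G : graph n s'.+1).
Local Notation s := s'.+1.
Local Notation m := (#|K|.-1).
Local Notation I := (vanishing_ideal (@toric_set K n s G)).

(** Index [ord0] gives 0, so the lifted indices leave [s - 1] binomials. *)
Definition torus_binomial (i : 'I_s) : {mpoly K[s]} :=
  'X_i ^+ m - 'X_ord0 ^+ m.

Lemma torus_binomial_homog i : torus_binomial i \is m.-homog.
Proof.
by rewrite rpredB // mpolyXn dhomogX /= mdegMn mdeg1 mul1n.
Qed.

Lemma torus_binomial_vanishes i (y : 'I_s -> K) :
  (forall j, y j != 0) -> (torus_binomial i).@[y] = 0.
Proof.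
move=> y0; rewrite mevalB !mpolyXn !mevalX.
suff e k : \prod_(j < s) y j ^+ (U_(k) *+ m)%MM j = 1 by rewrite !e subrr.
by rewrite big1 // => j _; rewrite mulmnE mnm1E expf_dvd ?dvdn_mull.
Qed.

Lemma torus_binomial_mem i : I (torus_binomial i).
Proof.
apply/vanishing_ideal_gen => //; apply: ideal_gen_mem; split.
  by exists m; apply: torus_binomial_homog.
move=> x x0; apply: torus_binomial_vanishes => j.
exact: edge_monomials_neq0.
Qed.

Lemma mcoeff_torus_binomial_pure i j :
  (torus_binomial i)@_(U_(j) *+ m) = (i == j)%:R - (j == ord0)%:R.
Proof.
rewrite mcoeffB !mcoeffXn.
suff e k : ((U_(k) *+ m)%MM == (U_(j) *+ m)%MM) = (k == j).
  by rewrite !e (eq_sym ord0).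
apply/eqP/eqP => [/mnmP/(_ j)|-> //]; rewrite !mulmnE !mnm1E eqxx mul1n => /eqP.
by case: (eqVneq k j) => // _; rewrite mul0n eq_sym -leqn0 leqNgt cardK_pred_gt0.
Qed.

(* The coefficients of [t_j ^ m] see only the generators of degree [m]: they give
   [A *m M = 1], where [A] collects the constant terms of the coefficients
   expressing the [t_i ^ m - t_0 ^ m] in terms of the [g i]. As [A] is square,
   every [g i] has degree [m] and is a linear combination of the
   [t_i ^ m - t_0 ^ m]. *)
Lemma complete_intersection_vanishes_on_torus (h : {mpoly K[s]}) (y : 'I_s -> K) :
  complete_intersection I -> I h -> (forall j, y j != 0) -> h.@[y] = 0.
Proof.
move=> [g [ghom gI]] Ih y0.
have gX i : vanishes_on_param G (g i).
  by apply: vanishing_ideal_vanishes => //; apply/gI/ideal_gen_mem; exists i.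
(* A proper divisor of [t_j^m] is a power of [t_j] of degree below [m], which does not occur in
   [g i]. *)
have pure c i j : (c * g i)@_(U_(j) *+ m) = c@_0 * (g i)@_(U_(j) *+ m).
  apply: mcoeffM_lowest => a le ne; have [d hd] := ghom i.
  have ma : (mdeg a < m)%N.
    by have := lem_mdeg_lt le ne; rewrite mdegMn mdeg1 mul1n.
  have [da|da] := eqVneq (mdeg a) d; last exact: mcoeff_homog hd da.
  rewrite (lem_mulmn1 le); apply: vanishes_on_param_pure (gX i) => //.
  by rewrite da.
have /fin_all_exists[c cE] (k : 'I_s') : exists c : 'I_s' -> {mpoly K[s]},
    torus_binomial (lift ord0 k) = \sum_i c i * g i.
  exact/ideal_gen_family/gI/torus_binomial_mem.
pose A : 'M[K]_s' := \matrix_(k, i) (c k i)@_0.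
pose M : 'M[K]_s' := \matrix_(i, l) (g i)@_(U_(lift ord0 l) *+ m).
have AM1 : A *m M = 1%:M.
  apply/matrixP => k l; rewrite !mxE.
  have := mcoeff_torus_binomial_pure (lift ord0 k) (lift ord0 l).
  rewrite (inj_eq lift_inj) subr0 => <-; rewrite cE raddf_sum.
  by apply: eq_bigr => i _; rewrite !mxE -pure.
have MA1 := mulmx1C AM1.
(* Row [i] of [M] is nonzero because [M *m A] is the identity; so [g i] contains the [m]-th power of
   a variable, which fixes its degree. *)
have g_homog i : g i \is m.-homog.
  have [d hd] := ghom i; suff -> : m = d by [].
  have [l Ml] : exists l, M i l != 0.
    apply/existsP; rewrite -[[exists _, _]]negbK negb_exists.
    apply/negP => /forallP M0.
    have /matrixP/(_ i i)/eqP := MA1.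
    rewrite !mxE eqxx big1; first by rewrite eq_sym oner_eq0.
    move=> l _.
    by have /negPn/eqP -> := M0 l; rewrite mul0r.
  move: Ml; rewrite mxE -mcoeff_msupp => /(dhomogP _ _ _ hd) /= <-.
  by rewrite mdegMn mdeg1 mul1n.
(* Both sides have degree [m], so only the constant terms [A k i] of the coefficients survive. *)
have binE k : torus_binomial (lift ord0 k) = \sum_i A k i *: g i.
  apply/mpolyP => b; have [db|db] := eqVneq (mdeg b) m; last first.
    rewrite (mcoeff_homog (torus_binomial_homog _) db).
    symmetry; apply: mcoeff_homog db; apply: rpred_sum => i _.
    exact: rpredZ (g_homog i).
  rewrite cE !raddf_sum; apply: eq_bigr => i _ /=.
  rewrite mcoeffZ mxE; apply: mcoeffM_lowest => a le ne.
  by apply: mcoeff_homog (g_homog i) _; rewrite -db ltn_eqF // lem_mdeg_lt.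
have gE i : g i = \sum_k M i k *: torus_binomial (lift ord0 k).
  under eq_bigr => k _ do rewrite binE scaler_sumr.
  rewrite exchange_big /= (bigD1 i) //= [X in _ + X]big1 ?addr0 => [|l li].
    under eq_bigr => k _ do rewrite scalerA.
    rewrite -scaler_suml; have /matrixP/(_ i i) := MA1.
    by rewrite !mxE eqxx => ->; rewrite scale1r.
  under eq_bigr => k _ do rewrite scalerA.
  rewrite -scaler_suml; have /matrixP/(_ i l) := MA1.
  by rewrite !mxE eq_sym (negbTE li) => ->; rewrite scale0r.
apply: ideal_gen_vanishes ((gI h).1 Ih) => _ [i ->].
rewrite gE raddf_sum big1 // => k _.
by rewrite [LHS]mevalZ torus_binomial_vanishes ?mulr0.
Qed.

(** A relation with residues [a] puts [t^a - t_0^|a|] into the ideal, so this binomial vanishes on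
    the whole torus. At the point with coordinate [y] at [i] and 1 elsewhere, this gives
    [y^(a i) = 1] for every nonzero [y]. *)
Lemma complete_intersection_edge_independent :
  complete_intersection I -> edge_independent m G.
Proof.
move=> ci c cv csum i; pose a k := `|(c k %% m)%Z|%N.
have m0 : m%:Z != 0 by rewrite eqz_nat -lt0n cardK_pred_gt0.
have aE k : (a k)%:Z = (c k %% m)%Z by rewrite gez0_abs ?modz_ge0.
have dvd_a (P : pred 'I_s) : (m %| \sum_(k | P k) c k)%Z ->
    (m %| \sum_(k | P k) a k)%N.
  by rewrite dvdz_sum_modz // cardK_pred_gt0.
pose p : {mpoly K[s]} := 'X_[[multinom a k | k < s]] - 'X_ord0 ^+ (\sum_k a k)%N.
have Ip : I p.
  apply/vanishing_ideal_gen => //; apply: ideal_gen_mem; split.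
    exists (\sum_k a k)%N; rewrite rpredB // ?mpolyXn dhomogX /=.
      by rewrite mdegE; apply/eqP/eq_bigr => k _; rewrite mnmE.
    by rewrite mdegMn mdeg1 mul1n.
  move=> x x0; rewrite mevalB mpolyXn !mevalX.
  under [X in X - _]eq_bigr => k _ do rewrite mnmE.
  rewrite prod_edge_monomials big1 => [|j _]; last first.
    by apply: expf_dvd => //; apply: dvd_a.
  rewrite big1 ?subrr // => k _; rewrite mulmnE expf_dvd ?dvdn_mull ?dvd_a //.
  exact: edge_monomials_neq0.
have : (m %| a i)%N.
  apply: dvd_card_pred => y y0.
  have := complete_intersection_vanishes_on_torus
    (y := fun k => if k == i then y else 1) ci Ip.
  rewrite mevalB mpolyXn !mevalX => /(_ _)/eqP.
  rewrite subr_eq0 [X in _ == X]big1 => [|k _]; last first.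
    rewrite mulmnE expf_dvd ?dvdn_mull ?dvd_a //.
    by case: ifP; rewrite ?oner_eq0.
  rewrite (bigD1 i) //= eqxx mnmE big1 ?mulr1.
    by move=> H; apply/eqP/H => j; case: ifP; rewrite ?oner_eq0.
  by move=> k /negbTE ->; rewrite expr1n.
by move=> /dvdnP[d ad]; rewrite (divz_eq (c i) m) -aE ad PoszM -mulrDl dvdz_mull.
Qed.

(** * Independence implies complete intersection *)

Lemma edge_weights_eqmodP (a b : 'X_{1..s}) :
  edge_independent m G -> mdeg a = mdeg b ->
  [forall j : 'I_n, (\sum_(i | j \in edge G i) a i)%N
      == (\sum_(i | j \in edge G i) b i)%N %[mod m]]
  = [forall i, a i == b i %[mod m]].
Proof.
move=> ind ab; apply/forallP/forallP => eq_ab; last first.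
  move=> j; rewrite -modn_summ -[X in _ == X]modn_summ; apply/eqP.
  by congr (_ %% _)%N; apply: eq_bigr => i _; apply/eqP.
have sumB (P : pred 'I_s) : \sum_(i | P i) ((a i)%:Z - (b i)%:Z)
    = (\sum_(i | P i) a i)%N%:Z - (\sum_(i | P i) b i)%N%:Z.
  by rewrite sumrB !(big_morph Posz PoszD (erefl _)).
move=> i; rewrite -eqz_nat -!modz_nat eqz_mod_dvd.
(* Equal degrees make these differences sum to zero, as the degree condition requires. *)
apply: (ind (fun i => (a i)%:Z - (b i)%:Z)) => [x|].
  by rewrite sumB -eqz_mod_dvd !modz_nat eqz_nat.
by rewrite sumB -!mdegE ab subrr dvdz0.
Qed.

Local Notation J :=
  (ideal_gen (fun p => exists k, p = torus_binomial (lift ord0 k))).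

Lemma torus_binomial_ideal i : J (torus_binomial i).
Proof.
case: (unliftP ord0 i) => [k ->|->]; first by apply: ideal_gen_mem; exists k.
by rewrite /torus_binomial subrr; apply: ideal_gen0.
Qed.

(* The normal form of a monomial of degree [d] modulo [J]: every exponent except
   that of [t_0] is reduced modulo [m]. *)
Definition reduced_monomial (d : nat) (e : 'I_s -> nat) : {mpoly K[s]} :=
  'X_ord0 ^+ (d - \sum_i e i)%N * \prod_i 'X_i ^+ e i.

(** Split each [t_i^(a i)] into a power of [t_i^m] and a remainder, and replace [t_i^m] by
    [t_0^m]. *)
Lemma reduced_monomial_cong (a : 'X_{1..s}) :
  J ('X_[a] - reduced_monomial (mdeg a) (fun i => a i %% m)%N).
Proof.
have -> : reduced_monomial (mdeg a) (fun i => a i %% m)%N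
    = \prod_i (('X_ord0 ^+ m) ^+ (a i %/ m) * 'X_i ^+ (a i %% m)).
  rewrite big_split /=; congr (_ * _).
  under [RHS]eq_bigr => i _ do rewrite -exprM.
  rewrite prodrXr; congr (_ ^+ _).
  have -> : mdeg a = (\sum_i m * (a i %/ m) + \sum_i a i %% m)%N.
    rewrite mdegE -big_split /=; apply: eq_bigr => i _.
    by rewrite mulnC -divn_eq.
  by rewrite addnK.
rewrite mpolyXE_id; apply: ideal_gen_cong_prod => i.
rewrite {1}(divn_eq (a i) m) exprD mulnC exprM.
apply: ideal_gen_congM; last by rewrite subrr; apply: ideal_gen0.
exact/ideal_gen_congX/torus_binomial_ideal.
Qed.

Lemma vanishes_on_param_torus_ideal (p : {mpoly K[s]}) d :
  edge_independent m G -> p \is d.-homog -> vanishes_on_param G p -> J p.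
Proof.
move=> ind hp px.
have m_gt0 := cardK_pred_gt0 K.
pose rho (a : 'X_{1..s}) : {ffun 'I_s -> 'I_m} :=
  [ffun i => Ordinal (ltn_pmod (a i) m_gt0)].
(* Subtracting the normal forms does not change [p]: those with the same residues [e] coincide, and
   their coefficients form a class sum, which is 0. *)
have -> : p = \sum_(a <- msupp p)
    p@_a *: ('X_[a] - reduced_monomial d (fun i => a i %% m)%N).
  under eq_bigr => a _ do rewrite scalerBr.
  rewrite sumrB -mpolyE [X in _ - X](_ : _ = 0) ?subr0 //.
  transitivity (\sum_(a <- msupp p) p@_a *: reduced_monomial d (fun i => rho a i)).
    apply: eq_bigr => a _; rewrite /reduced_monomial.
    congr (_ *: ('X_ _ ^+ _ * _)).
      by congr (_ - _)%N; apply: eq_bigr => i _; rewrite ffunE.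
    by apply: eq_bigr => i _; rewrite ffunE.
  rewrite (partition_big rho predT) //= big1 // => e _.
  rewrite (eq_bigr (fun a => p@_a *: reduced_monomial d (fun i => e i)));
    last by move=> a /eqP <-.
  rewrite -scaler_suml.
  case: (altP (@hasP _ (fun a => rho a == e) (msupp p))) => [[b bp /eqP be]|none].
    suff -> : \sum_(a <- msupp p | rho a == e) p@_a = 0 by rewrite scale0r.
    rewrite -[RHS](vanishes_on_param_class b px) big_seq_cond [RHS]big_seq_cond.
    apply: eq_bigl => a; case: (boolP (a \in msupp p)) => //= ap.
    rewrite edge_weights_eqmodP //; last first.
      by rewrite (dhomogP _ _ _ hp a ap) (dhomogP _ _ _ hp b bp).
    rewrite -be; apply/eqP/forallP => [/ffunP eqr i|eqr].
      by have /(congr1 val) := eqr i; rewrite !ffunE /= => ->.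
    by apply/ffunP => i; apply/val_inj; rewrite !ffunE /=; apply/eqP.
  rewrite big_hasC ?scale0r //.
rewrite big_seq; apply: ideal_gen_sum => a ap; rewrite -mul_mpolyC.
apply: ideal_genM; rewrite -(dhomogP _ _ _ hp a ap).
exact: reduced_monomial_cong.
Qed.

Lemma edge_independent_complete_intersection :
  edge_independent m G -> complete_intersection I.
Proof.
move=> ind; exists (fun k : 'I_s' => torus_binomial (lift ord0 k)).
split=> [i|h]; first by exists m; apply: torus_binomial_homog.
split=> [/vanishing_ideal_gen-/(_ isT)|] hJ.
  apply: ideal_gen_trans hJ => p [[d hp] px].
  exact: vanishes_on_param_torus_ideal hp px.
apply/vanishing_ideal_gen => //; apply: ideal_gen_trans hJ => _ [k ->].
apply: ideal_gen_mem; split.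
  by exists m; apply: torus_binomial_homog.
move=> x x0; apply: torus_binomial_vanishes => j.
exact: edge_monomials_neq0.
Qed.

End CompleteIntersection.

(** * Cyclic sequences and parity *)

Section SeqNext.
Variable T : eqType.

Lemma cycle_rot_to (p : seq T) x : x \in p -> uniq p -> exists2 q,
  (forall e : rel T, cycle e p -> cycle e (x :: q))
  & [/\ uniq (x :: q), size p = (size q).+1, p =i x :: q
     & next p =1 next (x :: q)].
Proof.
move=> xp up; case/rot_to: (xp) => i q pq; exists q.
  by move=> e; rewrite -pq rot_cycle.
rewrite -pq rot_uniq up; split=> //; first by rewrite -(size_rot i) pq.
  by move=> y; rewrite mem_rot.
by move=> y; rewrite next_rot.
Qed.

Lemma next_next_neq (p : seq T) x :
  uniq p -> (2 < size p)%N -> x \in p -> next p (next p x) != x.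
Proof.
move=> up sp /cycle_rot_to/(_ up)[q _ [uq sq _ nq]].
rewrite !nq; move: sp; rewrite sq.
case: q uq {nq sq} => [|y [|z q]] //= /and4P[xy yz _ _] _.
rewrite eqxx; move: xy; rewrite !inE !negb_or => /and3P[xy xz _].
by rewrite [y == x]eq_sym (negbTE xy) eqxx eq_sym.
Qed.

Lemma path_neq_parity (col : T -> bool) x p :
  path (fun y z => col y != col z) x p ->
  col (last x p) = col x (+) odd (size p).
Proof.
elim: p x => [|y p IHp] x /=; first by rewrite addbF.
case/andP=> xy /IHp ->; rewrite addbN -addNb.
by case: (col x) (col y) xy => [] [].
Qed.

Lemma cycle_neq_even (col : T -> bool) p :
  cycle (fun y z => col y != col z) p -> ~~ odd (size p).
Proof.
case: p => // x p /path_neq_parity; rewrite last_rcons size_rcons /=.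
by case: (odd _); case: (col x).
Qed.

End SeqNext.

(** * Edges, closed walks and cycles *)

Section Graphs.
Variables (n s : nat) (G : graph n s).
Local Notation edge := (edge G).
Local Notation adj := (adj G).

Lemma edgeP i : exists x y, x != y /\ edge i = [set x; y].
Proof.
by apply/cards2P/eqP; apply: edge_card.
Qed.

Lemma edge_neq i x y : edge i = [set x; y] -> x != y.
Proof.
move=> ei; apply/eqP => xy; have := edge_card G i.
by rewrite ei xy setUid cards1.
Qed.

Lemma mem_edgeP i x : x \in edge i -> exists y, edge i = [set x; y].
Proof.
have [y [z [_ ->]]] := edgeP i; rewrite !inE => /orP[/eqP ->|/eqP ->].
  by exists z.
by exists y; rewrite setUC.
Qed.

Lemma sum_edge (V : nmodType) (F : 'I_n -> V) i x y :
  edge i = [set x; y] -> \sum_(z in edge i) F z = F x + F y.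
Proof.
move=> ei; rewrite ei big_setU1 ?big_set1 // inE; exact: edge_neq ei.
Qed.

Lemma sum_edges_vertex (F : 'I_s -> int) (P : pred 'I_n) :
  \sum_(x | P x) \sum_(i | x \in edge i) F i
    = \sum_i \sum_(x in edge i) (if P x then F i else 0).
Proof.
rewrite (exchange_big_dep predT) //=; apply: eq_bigr => i _.
rewrite [RHS]big_mkcond [LHS]big_mkcond /=; apply: eq_bigr => x _.
by case: (P x); case: (x \in _).
Qed.

Lemma is_cycle_walk p : (2 < size p)%N -> ucycle adj p ->
  is_cycle G (closed_walk_edges G p).
Proof. by move=> sp cp; exists p. Qed.

Lemma closed_walk_edgesP p i :
  reflect (exists2 x, x \in p & edge i = [set x; next p x])
          (i \in closed_walk_edges G p).
Proof.
rewrite inE; apply: (iffP existsP) => [[x /andP[xp /eqP ei]]|[x xp ei]].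
  by exists x.
by exists x; rewrite xp ei eqxx.
Qed.

Lemma closed_walk_edge p x : cycle adj p -> x \in p ->
  exists2 i, i \in closed_walk_edges G p & edge i = [set x; next p x].
Proof.
move=> cp xp; have /existsP[i /eqP ei] := next_cycle cp xp.
by exists i => //; apply/closed_walk_edgesP; exists x.
Qed.

(** Two vertices giving the same edge would each follow the other, which [next_next_neq]
    excludes. *)
Lemma card_closed_walk_edges p : (2 < size p)%N -> ucycle adj p ->
  #|closed_walk_edges G p| = size p.
Proof.
move=> sp /andP[cp up].
have -> : size p = #|[set [set x; next p x] | x in p]|.
  rewrite card_in_imset; first exact/esym/card_uniqP.
  move=> x y xp yp exy; apply/eqP; apply: contraT => xy.
  have : x \in [set y; next p y] by rewrite -exy set21.
  rewrite !inE (negbTE xy) => /eqP xE.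
  have : y \in [set x; next p x] by rewrite exy set21.
  rewrite !inE eq_sym (negbTE xy) => /eqP yE.
  by have := next_next_neq up sp xp; rewrite -yE -xE eqxx.
rewrite -(card_imset _ (@edge_inj _ _ G)); congr #|pred_of_set _|.
apply/setP => A; apply/imsetP/imsetP => [[i /closed_walk_edgesP[x xp ei] ->]|].
  by exists x.
by case=> x xp ->; have [i iC <-] := closed_walk_edge cp xp; exists i.
Qed.

(* A path in [S] of maximal length has a second [S]-edge at its endpoint, whose
   other end lies on the path and closes a cycle. *)
Lemma min_degree2_cycle (S : {set 'I_s}) : S != set0 ->
  (forall i x, i \in S -> x \in edge i ->
     exists j, [/\ j \in S, j != i & x \in edge j]) ->
  exists C, is_cycle G C /\ C \subset S.
Proof.
move=> /set0Pn[i0 i0S] deg2.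
pose eS x y := [exists i in S, edge i == [set x; y]].
have eS_adj : subrel eS adj.
  by move=> x y /existsP[i /andP[_ ei]]; apply/existsP; exists i.
have eSI i x y : i \in S -> edge i = [set x; y] -> eS x y.
  by move=> iS /eqP ei; apply/existsP; exists i; rewrite iS.
(* In place of a longest path: without a cycle every path extends at its first vertex [x], so all
   lengths occur. *)
have [//|longer] : (exists C, is_cycle G C /\ C \subset S) \/
    forall k, exists x y p,
      [/\ size p = k, path eS x (y :: p) & uniq (x :: y :: p)].
  apply: Classical_Prop.NNPP => /Classical_Prop.not_or_and[noC]; apply.
  elim=> [|k [x [y [p [<- xyp uxyp]]]]].
    have [x [y [xy ei]]] := edgeP i0; exists x, y, [::]; split=> //=.
      by rewrite (eSI i0).
    by rewrite inE xy.
  have /andP[/existsP[i /andP[iS /eqP ei]] yp] := xyp.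
  have xi : x \in edge i by rewrite ei set21.
  have [j [jS ji xj]] := deg2 i x iS xi.
  have [z ej] := mem_edgeP xj.
  have zy : z != y.
    by apply: contraNneq ji => zy; apply/eqP/(@edge_inj _ _ G); rewrite ej zy.
  have zx : eS z x by apply: (eSI j) => //; rewrite ej setUC.
  have [zp|zp] := boolP (z \in p); last first.
    exists z, x, (y :: p); split=> //; first by rewrite [path _ _ _]/= zx.
    rewrite cons_uniq uxyp andbT !inE !negb_or zy zp !andbT.
    by rewrite eq_sym (edge_neq ej).
  case: noC; case/splitPr: zp xyp uxyp => p1 p2 xyp uxyp.
  pose c := x :: y :: rcons p1 z.
  have cE : x :: y :: p1 ++ z :: p2 = c ++ p2 by rewrite /= cat_rcons.
  have uc : uniq c by move: uxyp; rewrite cE cat_uniq => /and3P[].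
  have cc : cycle eS c.
    move: xyp; rewrite /= rcons_path last_rcons zx andbT.
    by rewrite -cat_rcons cat_path => /and3P[-> -> _].
  exists (closed_walk_edges G c); split.
    apply: is_cycle_walk; first by rewrite /= size_rcons.
    by rewrite /ucycle uc andbT; apply: sub_cycle cc.
  apply/subsetP => k' /closed_walk_edgesP[w wc ek].
  have /existsP[l /andP[lS /eqP el]] := next_cycle cc wc.
  by rewrite (@edge_inj _ _ G k' l) ?ek ?el.
(* This path has [n + 2] distinct vertices. *)
have [x [y [p [sp _ up]]]] := longer n.
have := max_card (mem (x :: y :: p)); rewrite (card_uniqP up) card_ord /= sp.
by rewrite ltnNge leqnSn.
Qed.

(** * Acyclic edge sets and 2-colourings *)

Definition acyclic (S : {set 'I_s}) : Prop :=
  forall C, is_cycle G C -> ~~ (C \subset S).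

Lemma acyclic_leaf (S : {set 'I_s}) : S != set0 -> acyclic S ->
  exists i x, [/\ i \in S, x \in edge i
                & forall j, j \in S -> x \in edge j -> j = i].
Proof.
move=> S0 acyc.
case: (boolP [exists i in S, [exists x in edge i,
    [forall j in S, (x \in edge j) ==> (j == i)]]]).
  move=> /existsP[i /andP[iS /existsP[x /andP[xi /forallP leaf]]]].
  exists i, x; split=> // j jS xj; apply/eqP.
  by have := leaf j; rewrite jS xj.
rewrite negb_exists => /forallP no_leaf.
have [C [cC CS]] : exists C, is_cycle G C /\ C \subset S.
  apply: min_degree2_cycle => // i x iS xi.
  have := no_leaf i; rewrite iS negb_exists => /forallP/(_ x).
  rewrite xi negb_forall => /existsP[j].
  rewrite !negb_imply => /and3P[jS xj ji].
  by exists j.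
by have := acyc C cC; rewrite CS.
Qed.

(** Remove a leaf edge, colour the rest by induction, and give the leaf the colour opposite to its
    neighbour. *)
Lemma acyclic_coloring (S : {set 'I_s}) : acyclic S ->
  exists col : 'I_n -> bool,
    forall i x y, i \in S -> edge i = [set x; y] -> col x != col y.
Proof.
have [k] := ubnP #|S|; elim: k S => // k IHk S /ltnSE Sk acyc.
have [->|S0] := eqVneq S set0; first by exists xpred0 => i x y; rewrite inE.
have [i [x [iS xi leaf]]] := acyclic_leaf S0 acyc.
have [||col colP] := IHk (S :\ i).
- by move: Sk; rewrite (cardsD1 i S) iS.
- move=> C cC; apply: contra (acyc C cC) => CS.
  exact: subset_trans CS (subD1set _ _).
have [y ei] := mem_edgeP xi; have xy := edge_neq ei.
exists (fun z => if z == x then ~~ col y else col z) => j a b jS ej.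
have [ji|ji] := eqVneq j i.
  have : a \in [set x; y] by rewrite -ei -ji ej set21.
  have : b \in [set x; y] by rewrite -ei -ji ej set22.
  have := edge_neq ej; rewrite !inE.
  move=> ab /orP[]/eqP bE /orP[]/eqP aE; move: ab; rewrite aE bE ?eqxx //= => _.
    by rewrite [y == x]eq_sym (negbTE xy); case: (col y).
  by rewrite [y == x]eq_sym (negbTE xy); case: (col y).
have xj : x \notin edge j by apply: contra ji => /(leaf j jS) ->.
have /norP[xa xb] : ~~ ((x == a) || (x == b)) by move: xj; rewrite ej !inE.
rewrite eq_sym in xa; rewrite eq_sym in xb; rewrite (negbTE xa) (negbTE xb).
by apply: colP ej; rewrite !inE ji.
Qed.

(** * Trees and odd unicyclic graphs are independent *)

Lemma support_cycle (m : nat) (c : 'I_s -> int) i0 :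
  (forall x : 'I_n, (m %| \sum_(i | x \in edge i) c i)%Z) ->
  ~~ (m %| c i0)%Z ->
  exists2 C, is_cycle G C & forall i, i \in C -> ~~ (m %| c i)%Z.
Proof.
move=> cv ci0; pose S := [set i | ~~ (m %| c i)%Z].
have [C [cC /subsetP CS]] : exists C, is_cycle G C /\ C \subset S.
  apply: min_degree2_cycle => [|i x iS xi].
    by apply/set0Pn; exists i0; rewrite inE.
  case: (boolP [exists j in S, (j != i) && (x \in edge j)]).
    by move=> /existsP[j /and3P[]]; exists j.
  rewrite negb_exists => /forallP none.
  (* If [i] were the only edge of [S] at [x], the relation at [x] would force [m] to divide
     [c i]. *)
  have := cv x; rewrite (bigD1 i) //= rpredDr => [ci|].
    by move: iS; rewrite inE ci.
  apply: rpred_sum => j /andP[xj ji]; have := none j.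
  by rewrite xj ji in_set !andbT negbK.
by exists C => // i /CS; rewrite inE.
Qed.

Lemma tree_edge_independent (m : nat) : is_tree G -> edge_independent m G.
Proof.
move=> [_ noC] c cv _ i; apply: contraT => ci.
by have [C /noC] := support_cycle cv ci.
Qed.

(* Deleting an edge [e] of the odd cycle leaves a properly 2-colourable graph in
   which the ends of [e] have the same colour. Summing the relations over the
   vertices of that colour counts [e] twice and every other edge once. *)
Lemma odd_unicyclic_edge_independent (m : nat) :
  odd_unicyclic G -> edge_independent m G.
Proof.
move=> [[C [cC uniqC]] oddC] c cv csum i; apply: contraT => ci.
have [C' cC' C'S] := support_cycle cv ci.
have {C' cC' C'S} CS e : e \in C -> ~~ (m %| c e)%Z.
  by rewrite (uniqC C' cC') => /C'S.
have [p [sp ucp CE]] := cC; have /andP[cp up] := ucp.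
have [e eC] : exists e, e \in C.
  apply/set0Pn; rewrite -card_gt0 CE card_closed_walk_edges //.
  exact: leq_trans sp.
have acyc : acyclic (~: [set e]).
  move=> C' /uniqC <-; apply/subsetP => /(_ e eC).
  by rewrite !inE eqxx.
have [col colP] := acyclic_coloring acyc.
have [u [v [uv ee]]] := edgeP e.
(* Otherwise [col] would properly colour every edge, and the cycle [p] would be even. *)
have col_uv : col u = col v.
  apply/eqP; apply: contraT => ne_uv.
  have : ~~ odd (size p).
    apply: (@cycle_neq_even _ col).
    apply: sub_cycle cp => x y /existsP[j /eqP ej].
    have [je|je] := eqVneq j e; last by apply: colP ej; rewrite !inE.
    have : x \in [set u; v] by rewrite -ee -je ej set21.
    have : y \in [set u; v] by rewrite -ee -je ej set22.
    have := edge_neq ej; rewrite !inE.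
    move=> xy /orP[]/eqP yE /orP[]/eqP xE; move: xy; rewrite xE yE ?eqxx //.
    by move=> _; rewrite eq_sym.
  by rewrite -(card_closed_walk_edges sp ucp) -CE oddC.
have : (m %| \sum_(x | col x == col u) \sum_(j | x \in edge j) c j)%Z.
  by apply: rpred_sum => x _; apply: cv.
rewrite sum_edges_vertex.
have -> : \sum_j \sum_(x in edge j) (if col x == col u then c j else 0)
    = \sum_j c j + c e.
  rewrite [LHS](bigD1 e) // [X in _ = X + _](bigD1 e) //= addrAC.
  congr (_ + _); first by rewrite (sum_edge _ ee) col_uv eqxx.
  apply: eq_bigr => j je; have [x [y [_ ej]]] := edgeP j.
  rewrite (sum_edge _ ej); have : col x != col y by apply: colP ej; rewrite !inE.
  by case: (col x); case: (col y); case: (col u); rewrite //= ?add0r ?addr0.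
by rewrite rpredDl // => ce; have := CS e eC; rewrite ce.
Qed.

(** * Alternating walks and the cycles of an independent graph *)

(* The vertex sums are those of alternating signs +1, -1, +1, .. along a walk of
   parity [b] from [v] to [w] avoiding [e]. *)
Definition alternating (e : 'I_s) (b : bool) (v w : 'I_n) : Prop :=
  exists c : 'I_s -> int, c e = 0 /\
    forall x, \sum_(i | x \in edge i) c i
                = (x == v)%:R - (-1) ^+ b * (x == w)%:R.

Lemma alternating_refl e v : alternating e false v v.
Proof.
by exists (fun=> 0); split=> // x; rewrite big1 // expr0 mul1r subrr.
Qed.

Lemma alternating_trans e b b' v w z :
  alternating e b v w -> alternating e b' w z -> alternating e (b (+) b') v z.
Proof.
move=> [c [ce cv]] [c' [c'e c'v]]; exists (fun i => c i + (-1) ^+ b * c' i).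
split=> [|x]; first by rewrite ce c'e mulr0 addr0.
rewrite big_split -mulr_sumr /= cv c'v mulrBr addrA subrK.
by rewrite mulrA -signr_addb.
Qed.

Lemma alternating_sym e b v w : alternating e b v w -> alternating e b w v.
Proof.
move=> [c [ce cv]]; exists (fun i => - (-1) ^+ b * c i).
split=> [|x]; first by rewrite ce mulr0.
rewrite -mulr_sumr cv mulrBr !mulNr mulrA -expr2 sqrr_sign mul1r opprK.
by rewrite addrC.
Qed.

Lemma alternating_edge e i v w : i != e -> edge i = [set v; w] ->
  alternating e true v w.
Proof.
move=> ie ei; exists (fun j => (j == i)%:R).
split=> [|x]; first by rewrite eq_sym (negbTE ie).
rewrite expr1 mulN1r opprK -natrD.
have -> : ((x == v) + (x == w))%N = (x \in edge i).
  rewrite ei !inE; have := edge_neq ei.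
  by case: (eqVneq x v) => [->|] // /negbTE ->.
rewrite big_mkcond (bigD1 i) //= eqxx big1 ?addr0; first by case: (_ \in _).
by move=> j /negbTE ->; rewrite if_same.
Qed.

Definition adj_avoiding (e : 'I_s) : rel 'I_n :=
  fun x y => [exists i, (i != e) && (edge i == [set x; y])].

Lemma alternating_path e x p : path (adj_avoiding e) x p ->
  alternating e (odd (size p)) x (last x p).
Proof.
elim: p x => [|y p IHp] x /=; first by move=> _; apply: alternating_refl.
case/andP=> /existsP[i /andP[ie /eqP ei]] /IHp.
exact: alternating_trans (alternating_edge ie ei).
Qed.

(** Deleting [e] from the cycle leaves a path of [size p - 1] edges between its ends. *)
Lemma alternating_cycle_edge e p : (2 < size p)%N -> ucycle adj p ->
  e \in closed_walk_edges G p ->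
  exists u v, edge e = [set u; v] /\ alternating e (~~ odd (size p)) v u.
Proof.
move=> sp /andP[cp up] /closed_walk_edgesP[x xp ee].
have [q /(_ _ cp) cq [uq sq _ nq]] := cycle_rot_to xp up.
exists x, (next p x); split=> //; move: ee sp; rewrite nq sq.
case: q cq uq {sq nq} => [|y q] //=; rewrite eqxx rcons_path.
move=> /and3P[xy yq qx] /andP[xyq yuq] ee q0.
have -> : ~~ ~~ ~~ odd (size q) = odd (size (rcons q x)).
  by rewrite size_rcons negbK.
rewrite -[X in alternating _ _ _ X](last_rcons y q x).
apply: alternating_path; rewrite rcons_path; apply/andP; split.
  apply: (@sub_in_path _ (predC1 x) adj) yq => [a b|].
    rewrite !inE => ax bx /existsP[i ei]; apply/existsP; exists i.
    rewrite ei andbT; apply: contraNneq ax => ie.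
    move: ei; rewrite ie ee => /eqP/setP/(_ x); rewrite !inE eqxx /=.
    by rewrite [x == b]eq_sym (negbTE bx) orbF eq_sym => /esym.
  apply/allP => z zyq; apply: contraNneq xyq.
  by move=> <-.
(* The closing edge could be [e] only if the path ended at [y], impossible since [q] is nonempty. *)
have /existsP[i ei] := qx; apply/existsP; exists i; rewrite ei andbT.
apply/eqP => ie; move: ei; rewrite ie ee => /eqP/setP/(_ (last y q)).
rewrite !inE eqxx orTb => /orP[/eqP lx|/eqP ly].
  by move: xyq; rewrite -lx mem_last.
case: q q0 ly yuq {qx yq xyq} => // z q _ /= lz.
by rewrite -{1}lz mem_last.
Qed.

Lemma alternating_cycle_avoiding e p x : cycle adj p -> uniq p -> x \in p ->
  e \notin closed_walk_edges G p -> alternating e (odd (size p)) x x.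
Proof.
move=> cp up xp eC.
have cp' : cycle (adj_avoiding e) p.
  apply: cycle_from_next up _ => y yp.
  have [i iC /eqP ei] := closed_walk_edge cp yp.
  by apply/existsP; exists i; rewrite ei andbT; apply: contraNneq eC => <-.
have [q /(_ _ cp') cq [_ -> _ _]] := cycle_rot_to xp up.
have := alternating_path cq; by rewrite size_rcons last_rcons.
Qed.

(** Whenever the walk uses [e] it lands on [u] or [v], both already reached from [v] while avoiding
    [e]; restart there. *)
Lemma alternating_connect e u v b x : edge e = [set u; v] ->
  alternating e b v u -> connect adj v x -> exists b', alternating e b' v x.
Proof.
move=> ee evu /connectP[p vp ->].
elim/last_ind: p vp => [|p y IHp]; first by exists false; apply: alternating_refl.
rewrite rcons_path last_rcons => /andP[/IHp[b' vl] /existsP[i /eqP ei]].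
have [ie|ie] := eqVneq i e; last first.
  by exists (b' (+) true); apply: alternating_trans vl (alternating_edge ie ei).
have : y \in [set u; v] by rewrite -ee -ie ei set22.
rewrite !inE => /orP[]/eqP ->; first by exists b.
by exists false; apply: alternating_refl.
Qed.

(** Closing such a walk by [e] gives [d], whose vertex sums vanish but whose value at [e] is -1, not
    divisible by [m > 1]. *)
Lemma edge_independent_alternating (m : nat) e u v : (1 < m)%N ->
  edge_independent m G -> edge e = [set u; v] -> ~ alternating e true v u.
Proof.
move=> m1 ind ee [c [ce cv]].
pose d i : int := c i - (i == e)%:R.
have dv x : \sum_(i | x \in edge i) d i = 0.
  rewrite sumrB cv expr1 mulN1r opprK -natrD.
  have -> : \sum_(i | x \in edge i) (i == e)%:R = (x \in edge e)%:R :> int.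
    rewrite big_mkcond (bigD1 e) //= eqxx big1 ?addr0; first by case: (_ \in _).
    by move=> j /negbTE ->; rewrite if_same.
  rewrite ee !inE; have := edge_neq ee.
  by case: (eqVneq x u) => [-> /negbTE ->|]; rewrite ?addn0 subrr.
(* Each edge has two ends, so the vertex sums add up to twice the total. *)
have dsum : \sum_i d i = 0.
  have := sum_edges_vertex d predT; rewrite big1 // => sum2.
  have {sum2} : \sum_i d i *+ 2 = 0.
    rewrite [RHS]sum2; apply: eq_bigr => i _; have [x [y [_ ei]]] := edgeP i.
    by rewrite (sum_edge _ ei).
  by rewrite sumrMnl => /eqP; rewrite Num.Theory.mulrn_eq0 => /eqP.
have : (m %| d e)%Z by apply: ind => [x|]; rewrite ?dv ?dsum dvdz0.
rewrite /d ce eqxx sub0r dvdzE /= dvdn1 => /eqP me.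
by rewrite me in m1.
Qed.

(** Removing an edge from an even cycle leaves an odd alternating walk between its ends. *)
Lemma edge_independent_odd_cycle (m : nat) C : (1 < m)%N ->
  edge_independent m G -> is_cycle G C -> odd #|C|.
Proof.
move=> m1 ind [p [sp ucp ->]]; rewrite card_closed_walk_edges //.
apply: contraT => evenp.
have /card_gt0P[e eC] : (0 < #|closed_walk_edges G p|)%N.
  by rewrite card_closed_walk_edges // (leq_trans _ sp).
have [u [v [ee]]] := alternating_cycle_edge sp ucp eC.
by rewrite evenp => /(edge_independent_alternating m1 ind ee).
Qed.

(* Given an edge [e] of one odd cycle that another odd cycle avoids, walk from
   one end of [e] to the second cycle, around it, back, and then along the rest
   of the first cycle. *)
Lemma edge_independent_cycle_sub (m : nat) C C' : (1 < m)%N ->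
  connected_graph G -> edge_independent m G ->
  is_cycle G C -> is_cycle G C' -> C \subset C'.
Proof.
move=> m1 conn ind cC cC'; apply/subsetP => e eC; apply: contraT => eC'.
have oC := edge_independent_odd_cycle m1 ind cC.
have oC' := edge_independent_odd_cycle m1 ind cC'.
have [p [sp ucp CE]] := cC; have [q [sq ucq C'E]] := cC'.
rewrite CE card_closed_walk_edges // in oC.
rewrite C'E card_closed_walk_edges // in oC'.
rewrite CE in eC; rewrite C'E in eC'.
have [u [v [ee]]] := alternating_cycle_edge sp ucp eC.
rewrite oC /= => vu; have /andP[cq uq] := ucq.
have [z zq] : exists z, z \in q.
  by exists (nth u q 0); apply: mem_nth; apply: leq_trans sq.
have [b vz] := alternating_connect ee vu (conn v z).
have zz := alternating_cycle_avoiding cq uq zq eC'.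
(* The way to [z] and back cancels in parity; the odd second cycle and the even rest of the first
   make the total odd. *)
have := alternating_trans (alternating_trans (alternating_trans vz zz)
  (alternating_sym vz)) vu.
rewrite oC' addbF addbC addbA addbb addFb.
by move=> /(edge_independent_alternating m1 ind ee).
Qed.

Lemma edge_independent_graph (m : nat) : (1 < m)%N -> connected_graph G ->
  edge_independent m G <-> is_tree G \/ odd_unicyclic G.
Proof.
move=> m1 conn; split=> [ind|[]]; last first.
- exact: odd_unicyclic_edge_independent.
- exact: tree_edge_independent.
have [[C cC]|noC] := Classical_Prop.classic (exists C, is_cycle G C).
  right; split; last by move=> C'; apply: edge_independent_odd_cycle m1 ind.
  exists C; split=> // C' cC'; apply/eqP.
  by rewrite eqEsubset !(edge_independent_cycle_sub m1).
by left; split=> // C cC; case: noC; exists C.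
Qed.

End Graphs.

Theorem proposition4p9 (K : finFieldType) (n s : nat) (G : graph n s) :
  #|K| <> 2%N -> (1 <= s)%N -> connected_graph G ->
  complete_intersection (vanishing_ideal (@toric_set K n s G)) <->
  is_tree G \/ odd_unicyclic G.
Proof.
move=> K2 s1 conn.
(* This is where [q] must differ from 2: modulo 1 every graph is independent. *)
have m1 : (1 < #|K|.-1)%N.
  by case: #|K| (finNzRing_gt1 K) K2 => [|[|[|k]]].
case: s G s1 conn => // s' G _ conn.
rewrite -(edge_independent_graph m1 conn); split.
  exact: complete_intersection_edge_independent.
exact: edge_independent_complete_intersection.
Qed.
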